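(* Let $A$ be any $n\times n$ real symmetric positive definite matrix. If the Kantorovich function $K(x)=(x^TAx)(x^TA^{-1}x)$ is convex on $\mathbb{R}^n$, then $\kappa(A)\le 3+2\sqrt{2}$.
   Context: $\kappa(A)=\lambda_{\max}(A)/\lambda_{\min}(A)$ denotes the condition number of the positive definite matrix $A$, i.e. the ratio of its largest to its smallest eigenvalue. *)

(* Defs.v *)
From HB Require Import structures.
From mathcomp Require Import all_boot all_order all_algebra.
From mathcomp Require Import all_classical all_reals all_analysis.

Set Implicit Arguments.
Unset Strict Implicit.
Unset Printing Implicit Defensive.

Import Order.TTheory GRing.Theory Num.Theory.

Local Open Scope classical_set_scope.
Local Open Scope ring_scope.

Definition quad_form (R : realType) (n : nat) (A : 'M[R]_n) (x : 'cV[R]_n) : R :=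
  (x^T *m A *m x) 0 0.

Definition posdef (R : realType) (n : nat) (A : 'M[R]_n) : Prop :=
  forall x : 'cV[R]_n, x != 0 -> 0 < quad_form A x.

Definition spectrum (R : realType) (n : nat) (A : 'M[R]_n) : set R :=
  [set a | eigenvalue A a].

(* The spectrum is finite, so when it is nonempty (always the case for a real
   symmetric matrix with n > 0) this supremum and infimum are its largest and
   smallest elements: see [lambda_maxP] and [lambda_minP]. *)
Definition lambda_max (R : realType) (n : nat) (A : 'M[R]_n) : R :=
  sup (spectrum A).

Definition lambda_min (R : realType) (n : nat) (A : 'M[R]_n) : R :=
  inf (spectrum A).

Definition cond_number (R : realType) (n : nat) (A : 'M[R]_n) : R :=
  lambda_max A / lambda_min A.

Definition kantorovich (R : realType) (n : nat) (A : 'M[R]_n) (x : 'cV[R]_n) : R :=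
  quad_form A x * quad_form (invmx A) x.

Lemma spectrum_seq (R : realType) (n : nat) (A : 'M[R]_n) :
  exists s : seq R, spectrum A = [set` s].
Proof.
apply/finite_seqP.
have p0 : char_poly A != 0 by rewrite monic_neq0 ?char_poly_monic.
apply: contrapT => /(infinite_set_fset (size (char_poly A)))[B BA].
apply/negP; rewrite -ltnNge.
apply: max_poly_roots => //; last exact: finmap.fset_uniq.
by apply/allP => a aB; rewrite -eigenvalue_root_char; exact: BA.
Qed.

Lemma seq_max (R : realDomainType) (s : seq R) : s != [::] ->
  exists2 m, m \in s & forall a, a \in s -> a <= m.
Proof.
elim: s => // x [_ _|y s /(_ isT)[m ms mub] _].
  by exists x; [exact: mem_head | move=> a; rewrite inE => /eqP ->].
exists (Num.max x m) => [|a].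
  by case: leP => _; rewrite ?mem_head // in_cons ms orbT.
by rewrite in_cons => /predU1P[->|/mub am]; rewrite le_max ?lexx ?am ?orbT.
Qed.

Lemma lambda_maxP (R : realType) (n : nat) (A : 'M[R]_n) :
  spectrum A !=set0 ->
  eigenvalue A (lambda_max A) /\
  forall a, eigenvalue A a -> a <= lambda_max A.
Proof.
have [s sA] := spectrum_seq A; move=> [x xA].
have /seq_max[m ms mub] : s != [::].
  by apply/eqP => s0; move: xA; rewrite sA s0.
have mA : spectrum A m by rewrite sA.
have ub : ubound (spectrum A) m by move=> a; rewrite sA => /mub.
have -> : lambda_max A = m.
  apply/eqP; rewrite eq_le ge_sup//=; last by exists m.
  by apply: ub_le_sup => //; exists m.
by split=> // a; exact: ub.
Qed.

Lemma lambda_minP (R : realType) (n : nat) (A : 'M[R]_n) :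
  spectrum A !=set0 ->
  eigenvalue A (lambda_min A) /\
  forall a, eigenvalue A a -> lambda_min A <= a.
Proof.
have [s sA] := spectrum_seq A; move=> [x xA].
have /seq_max[m /mapP[k ks ->] mub] : map -%R s != [::].
  by apply/eqP; case: s sA => // s0; move: xA; rewrite s0.
have kA : spectrum A k by rewrite sA.
have lb : lbound (spectrum A) k.
  by move=> a; rewrite sA => /(map_f -%R)/mub; rewrite lerN2.
have -> : lambda_min A = k.
  apply/eqP; rewrite eq_le lb_le_inf//=; last by exists k.
  by rewrite andbT; apply: ge_inf => //; exists k.
by split=> // a; exact: lb.
Qed.

(* Main.v *)
Require Import Defs.
From HB Require Import structures.
From mathcomp Require Import all_boot all_order all_algebra.
From mathcomp Require Import all_classical all_reals all_analysis.
From mathcomp Require Import ring lra.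

Set Implicit Arguments.
Unset Strict Implicit.
Unset Printing Implicit Defensive.

Import Order.TTheory GRing.Theory Num.Theory.

Local Open Scope classical_set_scope.
Local Open Scope ring_scope.

(** Restrict [K] to the plane spanned by orthonormal eigenvectors [u], [v]
for the extreme eigenvalues [a = lambda_max] and [b = lambda_min]. There it is
the binary quartic
  [(a s^2 + b t^2) (s^2 / a + t^2 / b) = s^4 + (k + k^-1) s^2 t^2 + t^4]
with [k = a / b]. The direction along which such a quartic [s^4 + c s^2 t^2 + t^4]
most easily fails to be convex is [(1, -1)] at the point [(1, 1)]: the second
derivative there is [24 - 4 c], so convexity forces [c <= 6]
([convex_quartic_bound]). Finally [k + k^-1 <= 6] says that [k] lies between
the two roots [3 -/+ 2 sqrt 2] of [k^2 - 6 k + 1] ([root_bound]).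

The vectors [u] and [v] are orthogonal because [A] is symmetric and [a != b]
([eigen_orthogonal]); when [a = b] the condition number is [1]. *)

Lemma convex_midpoint (R : realType) (E : lmodType R) (f : E -> R) (x y : E) :
  @convex_function R E setT f -> f (2^-1 *: (x + y)) *+ 2 <= f x + f y.
Proof.
have half_ge0 : 0 <= 2^-1 :> R by lra.
have half_le1 : 2^-1 <= 1 :> R by lra.
move=> /(_ (Itv01 half_ge0 half_le1) x y).
rewrite !in_setT => /(_ isT isT); rewrite convRE /conv /=.
have -> : unstable.onem 2^-1 = 2^-1 :> R by rewrite /unstable.onem; lra.
by rewrite -scalerDr -mulrDr mulrC ler_pdivlMr // mulr_natr.
Qed.

(** The hypothesis is midpoint convexity of [s^4 + c s^2 t^2 + t^4] at [(1, 1)]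
along [(1, -1)]. Divided by [2 h^2] it reads [0 <= (12 - 2 c) + (2 + c) h^2],
which tends to the second-order condition [0 <= 12 - 2 c] as [h] tends to [0]. *)
Lemma convex_quartic_bound (R : realFieldType) (c : R) (q : R -> R -> R) :
  (forall s t, q s t = s ^+ 4 + c * (s ^+ 2 * t ^+ 2) + t ^+ 4) ->
  (forall h, q 1 1 *+ 2 <= q (1 + h) (1 - h) + q (1 - h) (1 + h)) ->
  c <= 6.
Proof.
move=> qE qconv; rewrite leNgt; apply/negP => c6.
have d0 : 0 < c + 2 by lra.
(* With this [h] in ]0, 1[ the [h^2] term cannot compensate the negative
   constant: [(2 + c) h^2 < (2 + c) h = c - 6 < 2 c - 12]. *)
pose h := (c - 6) / (c + 2).
have hE : (c + 2) * h = c - 6 by rewrite /h mulrC divfK // gt_eqF.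
have h1 : h < 1 by rewrite /h ltr_pdivrMr //; lra.
have h0 : 0 < h by rewrite /h divr_gt0 //; lra.
have hh : (c + 2) * h * h < c - 6 by rewrite hE; nra.
have := qconv h; rewrite !qE.
have -> : (1 + h) ^+ 4 + c * ((1 + h) ^+ 2 * (1 - h) ^+ 2) + (1 - h) ^+ 4 +
  ((1 - h) ^+ 4 + c * ((1 - h) ^+ 2 * (1 + h) ^+ 2) + (1 + h) ^+ 4) =
  4 + 2 * c + (24 - 4 * c) * h ^+ 2 + 2 * ((c + 2) * h * h) * h ^+ 2.
  by ring.
have : 0 < h ^+ 2 by rewrite exprn_gt0.
set H := h ^+ 2 => H0; rewrite !expr1n; nra.
Qed.

Lemma root_bound (R : rcfType) (k : R) :
  0 < k -> k + k^-1 <= 6 -> k <= 3 + 2 * Num.sqrt 2.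
Proof.
move=> k0 kle; have s0 : 0 <= Num.sqrt 2 :> R by exact: sqrtr_ge0.
have s2 : Num.sqrt 2 ^+ 2 = 2 :> R by rewrite sqr_sqrtr.
have : k ^+ 2 + 1 <= 6 * k.
  have := ler_wpM2r (ltW k0) kle.
  by rewrite mulrDl mulVf ?gt_eqF.
rewrite leNgt => kk; apply/negP => ?; nra.
Qed.

Lemma row_sqnorm_gt0 (R : realDomainType) (n : nat) (u : 'rV[R]_n) :
  u != 0 -> 0 < (u *m u^T) 0 0.
Proof.
move=> u0; rewrite mxE lt_neqAle eq_sym sumr_ge0 ?andbT; last first.
  by move=> i _; rewrite mxE -expr2 sqr_ge0.
apply: contraNneq u0 => /psumr_eq0P uE; apply/eqP/rowP => i.
rewrite mxE; apply/eqP; rewrite -sqrf_eq0 expr2; apply/eqP.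
have := uE _ i isT; rewrite mxE; apply=> j _.
by rewrite mxE -expr2 sqr_ge0.
Qed.

Lemma unit_eigenvector (R : rcfType) (n : nat) (A : 'M[R]_n) (a : R) :
  eigenvalue A a ->
  exists2 u : 'rV[R]_n, u *m A = a *: u & u *m u^T = 1%:M.
Proof.
move=> /eigenvalueP[u uA /row_sqnorm_gt0 p0].
set p := _ 0 0 in p0; have r0 : Num.sqrt p != 0 by rewrite gt_eqF ?sqrtr_gt0.
exists ((Num.sqrt p)^-1 *: u).
  by rewrite -scalemxAl uA !scalerA mulrC.
rewrite linearZ /= -scalemxAl -scalemxAr scalerA [u *m u^T]mx11_scalar -/p.
rewrite scale_scalar_mx -expr2 exprVn sqr_sqrtr ?ltW //.
by rewrite mulVf ?gt_eqF.
Qed.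

Lemma eigen_orthogonal (R : fieldType) (n : nat) (A : 'M[R]_n)
    (a b : R) (u v : 'rV[R]_n) :
  A^T = A -> u *m A = a *: u -> v *m A = b *: v -> a != b -> u *m v^T = 0.
Proof.
move=> AT uA vA ab; have : (a - b) *: (u *m v^T) = 0.
  rewrite scalerBl scalemxAl -uA scalemxAr -linearZ /= -vA trmx_mul AT.
  by rewrite mulmxA subrr.
by move/eqP; rewrite scaler_eq0 subr_eq0 (negPf ab) => /eqP.
Qed.

Lemma eigen_invmx (R : fieldType) (n : nat) (A : 'M[R]_n) (a : R)
    (u : 'rV[R]_n) :
  A \in unitmx -> a != 0 -> u *m A = a *: u -> u *m invmx A = a^-1 *: u.
Proof.
move=> Au a0 uA; have -> : u *m invmx A = a^-1 *: (a *: u) *m invmx A.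
  by rewrite scalerK.
by rewrite -uA -scalemxAl mulmxK.
Qed.

Lemma posdef_unitmx (R : realType) (n : nat) (A : 'M[R]_n) :
  posdef A -> A \in unitmx.
Proof.
move=> A_pos; rewrite -row_free_unit -kermx_eq0.
apply/negPn/negP => /rowV0Pn[u /sub_kermxP uA u0].
have /A_pos : u^T != 0 by rewrite trmx_eq0.
by rewrite /quad_form trmxK uA mul0mx mxE ltxx.
Qed.

Lemma posdef_eigenvalue_gt0 (R : realType) (n : nat) (A : 'M[R]_n) (a : R) :
  posdef A -> eigenvalue A a -> 0 < a.
Proof.
move=> A_pos /unit_eigenvector[u uA uu].
have /A_pos : u^T != 0.
  apply/eqP => u0; move: uu; rewrite u0 mulmx0 => /matrixP/(_ 0 0)/eqP.
  by rewrite !mxE eq_sym oner_eq0.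
by rewrite /quad_form trmxK uA -scalemxAl uu !mxE mulr1.
Qed.

Lemma quad_form_eigenplane (R : realType) (n : nat) (B : 'M[R]_n)
    (a b s t : R) (u v : 'rV[R]_n) :
  u *m B = a *: u -> v *m B = b *: v ->
  u *m u^T = 1%:M -> v *m v^T = 1%:M -> u *m v^T = 0 ->
  quad_form B (s *: u^T + t *: v^T) = a * s ^+ 2 + b * t ^+ 2.
Proof.
move=> uB vB uu vv uv.
have vu : v *m u^T = 0 by rewrite -[v]trmxK -trmx_mul uv trmx0.
have xT : (s *: u^T + t *: v^T)^T = s *: u + t *: v.
  by apply/rowP => i; rewrite !mxE.
rewrite /quad_form xT mulmxDl -!scalemxAl uB vB.
rewrite mulmxDl !mulmxDr -!scalemxAl -!scalemxAr uu vv uv vu.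
by rewrite !mxE eqxx /=; ring.
Qed.

Lemma kantorovich_eigenplane (R : realType) (n : nat) (A : 'M[R]_n)
    (a b s t : R) (u v : 'rV[R]_n) :
  A \in unitmx -> a != 0 -> b != 0 ->
  u *m A = a *: u -> v *m A = b *: v ->
  u *m u^T = 1%:M -> v *m v^T = 1%:M -> u *m v^T = 0 ->
  kantorovich A (s *: u^T + t *: v^T) =
  s ^+ 4 + (a / b + (a / b)^-1) * (s ^+ 2 * t ^+ 2) + t ^+ 4.
Proof.
move=> Au a0 b0 uA vA uu vv uv; rewrite /kantorovich.
rewrite (quad_form_eigenplane _ _ uA vA) //.
rewrite (quad_form_eigenplane _ _ (eigen_invmx Au a0 uA)
  (eigen_invmx Au b0 vA)) //.
by field; rewrite a0 b0.
Qed.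

Lemma kantorovich_convex_ratio (R : realType) (n : nat) (A : 'M[R]_n)
    (a b : R) :
  A^T = A -> posdef A ->
  @convex_function R 'cV[R]_n setT (kantorovich A) ->
  eigenvalue A a -> eigenvalue A b -> a != b -> a / b + (a / b)^-1 <= 6.
Proof.
move=> AT A_pos K_convex ea eb ab.
have a0 : a != 0 by rewrite gt_eqF ?(posdef_eigenvalue_gt0 A_pos).
have b0 : b != 0 by rewrite gt_eqF ?(posdef_eigenvalue_gt0 A_pos).
have [u uA uu] := unit_eigenvector ea; have [v vA vv] := unit_eigenvector eb.
have uv := eigen_orthogonal AT uA vA ab.
apply: (@convex_quartic_bound _ _
  (fun s t => kantorovich A (s *: u^T + t *: v^T))) => [s t|h].
  exact: kantorovich_eigenplane (posdef_unitmx A_pos) a0 b0 uA vA uu vv uv.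
have -> : 1 *: u^T + 1 *: v^T = 2^-1 *:
    (((1 + h) *: u^T + (1 - h) *: v^T) + ((1 - h) *: u^T + (1 + h) *: v^T)).
  by apply/matrixP => i j; rewrite !mxE; field.
exact: convex_midpoint.
Qed.

Theorem theorem2p3 (R : realType) (n : nat) (A : 'M[R]_n)
  (A_sym : A \is symmetricmx) (A_pos : posdef A)
  (K_convex : @convex_function R 'cV[R]_n setT (kantorovich A)) :
  cond_number A <= 3 + 2 * Num.sqrt 2.
Proof.
have s0 : 0 <= Num.sqrt 2 :> R by exact: sqrtr_ge0.
have AT : A^T = A.
  move: A_sym; rewrite is_hermitianmxE expr0 scale1r map_mx_id // => /eqP.
  by move=> <-.
have [sp0|/set0P sp0] := eqVneq (spectrum A) set0.
  (* The supremum and infimum of the empty set are [0], and so is [0 / 0]. *)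
  rewrite /cond_number /lambda_max sp0 sup0 mul0r; lra.
have [ea _] := lambda_maxP sp0; have [eb _] := lambda_minP sp0.
have b0 := posdef_eigenvalue_gt0 A_pos eb.
have a0 := posdef_eigenvalue_gt0 A_pos ea.
rewrite /cond_number; have [->|ab] := eqVneq (lambda_max A) (lambda_min A).
  rewrite divff ?gt_eqF //; lra.
by apply: root_bound; [exact: divr_gt0 | exact: (kantorovich_convex_ratio AT)].
Qed.
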